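(* Let $z_1,z_2,\dots,z_n$ be complex numbers, let $1\le r\le n$, and let $\widetilde\gamma_r$ be the arithmetic mean of any subset of $r$ numbers chosen from $z_1,\dots,z_n$ (that is, $\widetilde\gamma_r=\frac1r\sum_{i\in I}z_i$ for some $I\subseteq\{1,\dots,n\}$ with $|I|=r$). Then $$\left|\widetilde\gamma_r-\widetilde z\right|^2\le\frac{n-r}{r}\,\sigma_z^2 .$$
   Context: For complex numbers $z_1,\dots,z_n$ put $\widetilde z=\frac1n\sum_{i=1}^n z_i$, and define $$S_z^2=\frac1n\sum_{i=1}^n|z_i-\widetilde z|^2,\qquad S^2=\frac1n\sum_{i=1}^n(z_i-\widetilde z)^2\in\mathbb{C},\qquad \sigma_z^2=\frac{|S^2|+S_z^2}{2}.$$ *)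

(* Defs.v *)
From mathcomp Require Import all_boot all_order all_algebra.
From mathcomp Require Import reals.
From mathcomp.real_closed Require Import complex.

Set Implicit Arguments.
Unset Strict Implicit.
Unset Printing Implicit Defensive.

Import GRing.Theory Num.Theory.
Local Open Scope ring_scope.

(* The modulus [`|x|] of [x : R[i]] is an element of R[i] with zero imaginary
   part; accordingly the real quantities below are valued in R[i], where
   [x <= y] means [Im x = Im y] and [Re x <= Re y]. *)

Definition mean (R : realType) (n : nat) (z : 'I_n -> R[i]) : R[i] :=
  n%:R^-1 * \sum_(i < n) z i.

Definition submean (R : realType) (n : nat) (z : 'I_n -> R[i])
    (I : {set 'I_n}) : R[i] :=
  #|I|%:R^-1 * \sum_(i in I) z i.

(* S_z^2 *)
Definition variance (R : realType) (n : nat) (z : 'I_n -> R[i]) : R[i] :=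
  n%:R^-1 * \sum_(i < n) `|z i - mean z| ^+ 2.

(* S^2, a complex number in general *)
Definition pseudo_variance (R : realType) (n : nat) (z : 'I_n -> R[i]) : R[i] :=
  n%:R^-1 * \sum_(i < n) (z i - mean z) ^+ 2.

(* sigma_z^2 *)
Definition sigma_sq (R : realType) (n : nat) (z : 'I_n -> R[i]) : R[i] :=
  (`|pseudo_variance z| + variance z) / 2%:R.

(* Main.v *)
Require Import Defs.
From mathcomp Require Import all_boot all_order all_algebra.
From mathcomp Require Import reals ring.
From mathcomp.real_closed Require Import complex.

Set Implicit Arguments.
Unset Strict Implicit.
Unset Printing Implicit Defensive.

Import Order.TTheory GRing.Theory Num.Theory.
Local Open Scope ring_scope.

(** For real weights [a] and complex [w], de Bruijn's refinement of the
    Cauchy-Schwarz inequality says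
      |sum a_i w_i|^2 <= (sum a_i^2) (|sum w_i^2| + sum |w_i|^2) / 2.
    A rotation by a unit [u] makes [u * sum a_i w_i] real and nonnegative, so
    that only the real parts of the [u w_i] contribute; real Cauchy-Schwarz
    applies to them, and the identity 2 (Re v)^2 = |v|^2 + Re (v^2) turns the
    sum of their squares into the right-hand factor, up to bounding
    Re (u^2 sum w_i^2) by its modulus ([de_Bruijn]).

    The theorem is the case where [w_i = z_i - mean z], whose second factor is
    [n * sigma_sq z].  Since these deviations sum to zero, adding a constant to
    the weights does not change [sum a_i w_i], while it changes [sum a_i^2]:
    the indicator of [I] is therefore best replaced by its centred version,
    scaled by [n] to clear denominators, [a_i = n 1_I(i) - r].  Then
    [sum a_i w_i = n r (submean z I - mean z)]
    ([sum_centred_indicator_mul]) and [sum a_i^2 = n r (n - r)]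
    ([sum_centred_indicator_sqr]); dividing by [(n r)^2] gives the bound. *)

(** The difference of the two sides is half of the sum of squares
    [(a i * x j - a j * x i) ^+ 2] in Lagrange's identity. *)
Lemma Cauchy_Schwarz_sum (C : numDomainType) (T : finType) (a x : T -> C) :
  (forall i, a i \is Num.real) -> (forall i, x i \is Num.real) ->
  (\sum_i a i * x i) ^+ 2 <= (\sum_i a i ^+ 2) * (\sum_i x i ^+ 2).
Proof.
move=> ra rx; rewrite -subr_ge0 -(pmulr_rge0 _ (ltr0n C 2)).
set A := \sum_i a i ^+ 2; set X := \sum_i x i ^+ 2; set P := \sum_i a i * x i.
have -> : 2%:R * (A * X - P ^+ 2) = \sum_i \sum_j (a i * x j - a j * x i) ^+ 2.
  transitivity (\sum_i (a i ^+ 2 * X - a i * x i * (2%:R * P)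
                        + x i ^+ 2 * A)).
    by rewrite big_split sumrB /= -!mulr_suml -/A -/X -/P; ring.
  apply: eq_bigr => i _; rewrite /A /X /P !mulr_sumr -sumrB -big_split /=.
  by apply: eq_bigr => j _; ring.
apply: sumr_ge0 => i _; apply: sumr_ge0 => j _.
by rewrite real_exprn_even_ge0 // realB // realM.
Qed.

Lemma sqr_Re (C : numClosedFieldType) (w : C) :
  'Re w ^+ 2 = (`|w| ^+ 2 + 'Re (w ^+ 2)) / 2%:R.
Proof.
by rewrite normCK !ReE rmorphXn /=; field; rewrite ?pnatr_eq0.
Qed.

(** The plain Cauchy-Schwarz inequality has [\sum_i `|w i| ^+ 2] as its second
    factor; real weights allow the average with [`|\sum_i w i ^+ 2|], because
    after the rotation only one real coordinate of each [w i] matters. *)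
Lemma de_Bruijn (C : numClosedFieldType) (T : finType) (a w : T -> C) :
  (forall i, a i \is Num.real) ->
  `|\sum_i a i * w i| ^+ 2 <=
    (\sum_i a i ^+ 2) * ((`|\sum_i w i ^+ 2| + \sum_i `|w i| ^+ 2) / 2%:R).
Proof.
move=> ra; set s := \sum_i a i * w i.
have [u u1 us] : exists2 u : C, `|u| = 1 & u * s = `|s|.
  have [->|s0] := eqVneq s 0; first by exists 1; rewrite ?mulr0 ?normr0 ?normr1.
  have ns0 : `|s| != 0 by rewrite normr_eq0.
  by exists (`|s| / s); rewrite ?divfK // normf_div normr_id divff.
have -> : `|s| = \sum_i a i * 'Re (u * w i).
  have -> : `|s| = 'Re (u * s) by rewrite us (Creal_ReP _ _) ?normr_real.
  rewrite mulr_sumr raddf_sum /=; apply: eq_bigr => i _.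
  by rewrite mulrCA (ReMl (ra i)).
apply: le_trans (Cauchy_Schwarz_sum ra (fun i => Creal_Re (u * w i))) _.
apply: ler_wpM2l; first by apply: sumr_ge0 => i _; rewrite real_exprn_even_ge0.
under eq_bigr do rewrite sqr_Re normrM u1 mul1r exprMn.
rewrite -mulr_suml ler_pM2r ?invr_gt0 ?ltr0n //.
rewrite big_split /= addrC lerD2r -raddf_sum -mulr_sumr /=.
apply: le_trans (leif_Re_Creal _) _.
by rewrite normrM normrX u1 expr1n mul1r.
Qed.

Lemma sum_deviation (R : realType) (n : nat) (z : 'I_n -> R[i]) :
  (0 < n)%N -> \sum_i (z i - mean z) = 0.
Proof.
move=> n0; rewrite sumrB sumr_const card_ord -mulr_natl /mean mulrA.
by rewrite divff ?pnatr_eq0 -?lt0n // mul1r subrr.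
Qed.

Lemma submean_deviation (R : realType) (n : nat) (z : 'I_n -> R[i])
    (I : {set 'I_n}) :
  (0 < #|I|)%N ->
  submean z I - mean z = #|I|%:R^-1 * \sum_(i in I) (z i - mean z).
Proof.
move=> I0; rewrite sumrB sumr_const mulrBr -[mean z *+ _]mulr_natl mulrA.
by rewrite mulVf ?mul1r // pnatr_eq0 -lt0n.
Qed.

(** Against a family of sum zero, the constant [#|I|%:R] in the centred
    indicator has no effect. *)
Lemma sum_centred_indicator_mul (C : comPzRingType) (T : finType)
    (I : {set T}) (w : T -> C) : \sum_i w i = 0 ->
  \sum_i (#|T|%:R * (i \in I)%:R - #|I|%:R) * w i = #|T|%:R * \sum_(i in I) w i.
Proof.
move=> w0; under eq_bigr do rewrite mulrBl -mulrA.
rewrite sumrB -!mulr_sumr w0 mulr0 subr0 [in RHS]big_mkcond /=; congr (_ * _).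
by apply: eq_bigr => i _; case: (i \in I); rewrite ?mul1r ?mul0r.
Qed.

(** This is [#|T| ^ 3] times the variance [p (1 - p)] of an
    indicator of density [p = #|I| / #|T|]. *)
Lemma sum_centred_indicator_sqr (C : comPzRingType) (T : finType) (I : {set T}) :
  \sum_i (#|T|%:R * (i \in I)%:R - #|I|%:R) ^+ 2
    = #|T|%:R * #|I|%:R * (#|T|%:R - #|I|%:R) :> C.
Proof.
have sI : \sum_(i : T) (i \in I)%:R = #|I|%:R :> C.
  by rewrite -sum1_card natr_sum [RHS]big_mkcond; apply: eq_bigr => i _; case: (i \in I).
transitivity (\sum_(i : T) ((#|T|%:R ^+ 2 - 2%:R * #|T|%:R * #|I|%:R) * (i \in I)%:R
                      + #|I|%:R ^+ 2) : C).
  by apply: eq_bigr => i _; case: (i \in I); rewrite /=; ring.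
by rewrite big_split /= -mulr_sumr sI sumr_const -mulr_natl; ring.
Qed.

Theorem theorem2p3 (R : realType) (n r : nat) (z : 'I_n -> R[i])
    (I : {set 'I_n}) :
  (1 <= r)%N -> (r <= n)%N -> #|I| = r ->
  `|submean z I - mean z| ^+ 2 <= (n%:R - r%:R) / r%:R * sigma_sq z.
Proof.
move=> r0 rn Ir; have n0 := leq_trans r0 rn.
have rC : r%:R != 0 :> R[i] by rewrite pnatr_eq0 -lt0n.
have nC : n%:R != 0 :> R[i] by rewrite pnatr_eq0 -lt0n.
pose w i := z i - mean z.
have := @de_Bruijn R[i] _ (fun i => n%:R * (i \in I)%:R - r%:R) w
  (fun i => realB (realM (realn _ _) (realn _ _)) (realn _ _)).
have := sum_centred_indicator_mul I (sum_deviation z n0).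
have := sum_centred_indicator_sqr R[i] I.
rewrite card_ord Ir => -> ->.
have -> : \sum_(i in I) (z i - mean z) = r%:R * (submean z I - mean z).
  by rewrite submean_deviation Ir // mulrA divff // mul1r.
have -> : \sum_i w i ^+ 2 = n%:R * pseudo_variance z.
  by rewrite /pseudo_variance mulrA divff // mul1r.
have -> : \sum_i `|w i| ^+ 2 = n%:R * variance z.
  by rewrite /variance mulrA divff // mul1r.
rewrite mulrA (normrM (_ * _)) (normrM _ (pseudo_variance z)) normrM !normr_nat.
move=> le_dB.
have k0 : 0 < (n%:R * r%:R) ^+ 2 :> R[i].
  by rewrite exprn_gt0 // mulr_gt0 // ltr0n.
rewrite -(ler_pM2l k0) -exprMn (le_trans le_dB) // le_eqVlt.
by apply/orP; left; apply/eqP; rewrite /sigma_sq; field; rewrite rC.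
Qed.
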